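(* (1) Let $s,n\ge1$ be integers, let $q=2^n$, and let $A$, $Q$, $H_{A,Q}$ be as in the context with $A\simeq\mathbb Z^s$ and $\mathfrak S(Q)=\mathcal G_{2^n}\le\mathcal S_{2^n}$. Then the group $H_{A,Q}$ is $n$-solvable. (2) Given an integer $n\ge1$, there exist infinitely many pairwise non isomorphic $n$-solvable infinite subgroups of $\mathrm{IET}$.
   Context: An interval exchange transformation (iet) is a bijection $f:[0,1)\to[0,1)$ for which there is a finite partition of $[0,1)$ into half-open intervals $[a,b)$ on each of which $f$ is a translation. The iets form a group $\mathrm{IET}$ under composition. For $a\in\mathbb R/\mathbb Z$, $R_a\in\mathrm{IET}$ is the rotation $x\mapsto x+a \bmod 1$. For an integer $q\ge 1$ let $I_i=[\frac{i-1}{q},\frac{i}{q})$, $1\le i\le q$. For $\tau$ in the symmetric group $\mathcal S_q$ on $\{1,\dots,q\}$, $E_\tau$ is the iet that is a translation on each $I_i$ with $E_\tau(I_i)=I_{\tau(i)}$. Put $\mathcal G_{1/q}=\{E_\tau:\tau\in\mathcal S_q\}$; the map $\mathfrak S:\mathcal G_{1/q}\to\mathcal S_q$, $E_\tau\mapsto\tau$, is an isomorphism. $\sigma_q$ is the $q$-cycle $(1,2,\dots,q)\in\mathcal S_q$. Setup: $s,m,q\geq 1$ are integers; $\alpha_1,\dots,\alpha_s\in(\mathbb R/\mathbb Z)\setminus(\mathbb Q/\mathbb Z)$ are $\mathbb Q$-independent (i.e. $\sum n_i\alpha_i=0$ in $\mathbb R/\mathbb Z$ with $n_i\in\mathbb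 Z$ forces all $n_i=0$; equivalently, for real representatives, $1,\alpha_1,\dots,\alpha_s$ are linearly independent over $\mathbb Q$); $A=\langle\alpha_1,\dots,\alpha_s\rangle\simeq\mathbb Z^s$ is the subgroup of $\mathbb R/\mathbb Z$ they generate; $g_1,\dots,g_m\in\mathcal G_{1/q}$ and $Q=\langle g_1,\dots,g_m\rangle\le\mathcal G_{1/q}$; and $H_{A,Q}=\langle R_{\alpha_1},\dots,R_{\alpha_s},g_1,\dots,g_m\rangle\le\mathrm{IET}$. The groups $\mathcal G_{2^n}\le\mathcal S_{2^n}$ (not to be confused with $\mathcal G_{1/q}$) are defined inductively. $\mathcal G_2=\mathcal S_2$. Given $\mathcal G_{2^n}\le\mathcal S_{2^n}$, let $\tau=(\sigma_{2^{n+1}})^{2^n}\in\mathcal S_{2^{n+1}}$, i.e. $\tau(k)=k+2^n \bmod 2^{n+1}$; view $\mathcal G_{2^n}$ as a group of permutations of $\{1,\dots,2^{n+1}\}$ acting on $\{1,\dots,2^n\}$ and fixing the other points, let $\overline{\mathcal G_{2^n}}=\tau\mathcal G_{2^n}\tau$ (acting on $\{2^n+1,\dots,2^{n+1}\}$), and set $G_{2^{n+1}}=(\mathcal G_{2^n}\oplus\overline{\mathcal G_{2^n}})\rtimes\langle\tau\rangle\le\mathcal S_{2^{n+1}}$. With $\Pi_1$ the cycle $(1,2,\dots,2^n)$ (fixing all other points), $\tau\Pi_1$ is a $2^{n+1}$-cycle of $G_{2^{n+1}}$, and $\mathcal G_{2^{n+1}}$ is the conjugate of $G_{2^{n+1}}$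 in $\mathcal S_{2^{n+1}}$ by a permutation that conjugates $\tau\Pi_1$ to $\sigma_{2^{n+1}}$. A group $G$ is $n$-solvable ($n\ge1$) if its derived length is exactly $n$: $D^n(G)=\{\mathrm{Id}\}$ and $D^{n-1}(G)\neq\{\mathrm{Id}\}$, where $D^0(G)=G$ and $D^{k+1}(G)=[D^k(G),D^k(G)]$. *)

(* Defs.v *)
From HB Require Import structures.
From mathcomp Require Import all_boot all_order all_algebra all_fingroup.
From mathcomp Require Import lra zify.
From mathcomp Require Import boolp classical_sets functions cardinality reals.

Set Implicit Arguments.
Unset Strict Implicit.
Unset Printing Implicit Defensive.

Import Order.TTheory GRing.Theory Num.Theory.

Local Open Scope classical_set_scope.

Section AbstractGroups.
Local Open Scope group_scope.
Variable gT : groupType.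
Implicit Types (H S : set gT).

Definition is_subgroup H : Prop :=
  H 1 /\ forall x y, H x -> H y -> H (x * y^-1).

Definition gen S : set gT := smallest is_subgroup S.

Definition derived H : set gT := gen [set [~ x, y] | x in H & y in H].

Definition derived_series (k : nat) H : set gT := iter k derived H.

Definition n_solvable (n : nat) H : Prop :=
  [/\ (0 < n)%N, derived_series n H = [set 1] &
      derived_series n.-1 H <> [set 1]].

Definition isomorphic H S : Prop :=
  exists f : gT -> gT,
    set_bij H S f /\ forall x y, H x -> H y -> f (x * y) = f x * f y.

End AbstractGroups.

Local Open Scope ring_scope.

Definition I01 (R : realType) : Type := {x : R | 0 <= x < 1}.

Definition mkI01 (R : realType) (x : R) (x01 : 0 <= x < 1) : I01 R :=
  exist (fun y : R => is_true (0 <= y < 1)) x x01.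

(* The c i are translation vectors; the intervals [a i, b i[ are nonempty,
   contained in [0, 1[, and each point of [0, 1[ lies in exactly one. *)
Definition is_iet (R : realType) (f : I01 R -> I01 R) : Prop :=
  bijective f /\
  exists (k : nat) (a b c : 'I_k -> R),
    [/\ forall i, [/\ 0 <= a i, a i < b i & b i <= 1],
        forall x : I01 R, exists! i, a i <= val x < b i &
        forall i (x : I01 R), a i <= val x < b i -> val (f x) = val x + c i].

Record iet (R : realType) := Iet {
  iet_fun :> I01 R -> I01 R;
  ietP : is_iet iet_fun
}.

Section IetGroup.
Variable R : realType.
Implicit Types f g h : iet R.

Lemma iet_ext f g : iet_fun f =1 iet_fun g -> f = g.
Proof.
case: f g => [f fP] [g gP] /= /funext fg.
by subst g; congr Iet; exact: Prop_irrelevance.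
Qed.

(* Empty pieces and an arbitrary finite index type are harmless. *)
Lemma is_iet_fin (I : finType) (a b c : I -> R) (f : I01 R -> I01 R) :
  bijective f ->
  (forall i, a i < b i -> 0 <= a i /\ b i <= 1) ->
  (forall x : I01 R, exists! i, a i <= val x < b i) ->
  (forall i (x : I01 R), a i <= val x < b i -> val (f x) = val x + c i) ->
  is_iet f.
Proof.
move=> fbij ab01 part trans; split=> //.
pose J := {i : I | a i < b i}.
exists #|{: J}|.
pose e (k : 'I_#|{: J}|) : I := val (enum_val k : J).
exists (a \o e), (b \o e), (c \o e); split => /=.
- by move=> k; have [] := ab01 (e k) (valP (enum_val k : J));
    split=> //; exact: (valP (enum_val k : J)).
- move=> x; have [i [xi iu]] := part x.
  have abi : a i < b i by case/andP: xi => /le_lt_trans /[apply].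
  exists (enum_rank (exist _ i abi : J)); split.
    by rewrite /e enum_rankK.
  move=> k /iu ik; apply: enum_val_inj; rewrite enum_rankK.
  exact: val_inj.
- by move=> k x; exact: trans.
Qed.

Lemma is_iet_id : is_iet (@id (I01 R)).
Proof.
apply: (@is_iet_fin unit (fun=> 0) (fun=> 1) (fun=> 0)) => //.
- by exists id.
- by move=> x; exists tt; split=> [|[]//]; exact: (valP x).
- by move=> _ x _; rewrite addr0.
Qed.

Lemma is_iet_comp f g : is_iet (g \o f).
Proof.
have [fb [k1 [a1 [b1 [c1 [ab1 p1 t1]]]]]] := ietP f.
have [gb [k2 [a2 [b2 [c2 [ab2 p2 t2]]]]]] := ietP g.
have memE (i : 'I_k1) (j : 'I_k2) (x : I01 R) :
    Num.max (a1 i) (a2 j - c1 i) <= val x < Num.min (b1 i) (b2 j - c1 i) <->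
    (a1 i <= val x < b1 i) /\ (a2 j <= val (f x) < b2 j).
  rewrite ge_max lt_min lerBlDr ltrBrDr; split.
    move=> /andP[/andP[? ?] /andP[? ?]].
    have xi : a1 i <= val x < b1 i by apply/andP.
    by split=> //; rewrite (t1 _ _ xi); apply/andP.
  move=> [xi]; rewrite (t1 _ _ xi).
  by case/andP: xi => -> -> /andP[-> ->].
apply: (@is_iet_fin ('I_k1 * 'I_k2)%type
  (fun ij => Num.max (a1 ij.1) (a2 ij.2 - c1 ij.1))
  (fun ij => Num.min (b1 ij.1) (b2 ij.2 - c1 ij.1))
  (fun ij => c1 ij.1 + c2 ij.2)).
- exact: bij_comp.
- move=> [i j] _ /=; have [? ? ?] := ab1 i.
  by rewrite le_max ge_min; split; apply/orP; left.
- move=> x; have [i [xi iu]] := p1 x; have [j [xj ju]] := p2 (f x).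
  exists (i, j); split; first exact/memE.
  by move=> [i' j'] /memE/= [/iu-> /ju->].
- move=> [i j] x /memE/= [xi xj].
  by rewrite (t2 _ _ xj) (t1 _ _ xi) addrA.
Qed.

Lemma iet_inv_ex f : exists g : I01 R -> I01 R, cancel f g /\ cancel g f.
Proof. by have [[g fg gf] _] := ietP f; exists g. Qed.

Definition iet_invfun f : I01 R -> I01 R := sval (cid (iet_inv_ex f)).

Lemma iet_invfunK f : cancel f (iet_invfun f).
Proof. by rewrite /iet_invfun; case: cid => ? []. Qed.

Lemma iet_invfunKV f : cancel (iet_invfun f) f.
Proof. by rewrite /iet_invfun; case: cid => ? []. Qed.

Lemma is_iet_inv f : is_iet (iet_invfun f).
Proof.
have [_ [k [a [b [c [ab p t]]]]]] := ietP f.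
have memE i (y : I01 R) : a i + c i <= val y < b i + c i <->
    a i <= val (iet_invfun f y) < b i.
  split=> [/andP[ay yb]|yi]; last first.
    by rewrite -{1 2}(iet_invfunKV f y) (t _ _ yi) lerD2r ltrD2r.
  have [a0 _ b1] := ab i.
  have z01 : 0 <= val y - c i < 1 by apply/andP; split; lra.
  pose z : I01 R := mkI01 z01.
  have zi : a i <= val z < b i.
    by rewrite [val z]/=; apply/andP; split; [rewrite lerBrDr|rewrite ltrBlDr].
  have <- : z = iet_invfun f y.
    rewrite -[z](iet_invfunK f); congr (iet_invfun f _).
    by apply: val_inj; rewrite (t _ _ zi) /= subrK.
  exact: zi.
apply: (@is_iet_fin 'I_k (fun i => a i + c i) (fun i => b i + c i)
  (fun i => - c i)).
- by exists f; [exact: iet_invfunKV|exact: iet_invfunK].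
- move=> i _; have [a0 ltab b1] := ab i; split.
    have a01 : 0 <= a i < 1 by apply/andP; split; lra.
    rewrite -(t i (mkI01 a01)) /=; last by rewrite lexx.
    by case/andP: (valP (f (mkI01 a01))).
  rewrite leNgt; apply/negP => bc.
  pose w := Num.max (a i) (1 - c i).
  have wi : a i <= w < b i.
    by rewrite le_max lexx /= gt_max ltab /=; lra.
  have w01 : 0 <= w < 1.
    by case/andP: wi => w1 w2; apply/andP; split; lra.
  have := valP (f (mkI01 w01)); rewrite (t i) //= => /andP[_].
  by apply/negP; rewrite -leNgt -lerBlDr le_max lexx orbT.
- move=> y; have [i [yi iu]] := p (iet_invfun f y).
  by exists i; split=> [|j /memE /iu//]; exact/memE.
- move=> i y /memE yi; apply/eqP.
  by rewrite eq_sym subr_eq -(t _ _ yi) iet_invfunKV.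
Qed.

(* As for permutations, products are read from left to right:
   (f * g) x = g (f x). *)
Definition iet_mul f g : iet R := Iet (is_iet_comp f g).
Definition iet_one : iet R := Iet is_iet_id.
Definition iet_inv f : iet R := Iet (is_iet_inv f).

Lemma iet_mulA : associative iet_mul.
Proof. by move=> f g h; exact: iet_ext. Qed.
Lemma iet_mul1 : left_id iet_one iet_mul.
Proof. by move=> f; exact: iet_ext. Qed.
Lemma iet_mulr1 : right_id iet_one iet_mul.
Proof. by move=> f; exact: iet_ext. Qed.
Lemma iet_mulV : left_inverse iet_one iet_inv iet_mul.
Proof. by move=> f; apply: iet_ext => x; exact: iet_invfunKV. Qed.
Lemma iet_mulrV : right_inverse iet_one iet_inv iet_mul.
Proof. by move=> f; apply: iet_ext => x; exact: iet_invfunK. Qed.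

HB.instance Definition _ := gen_eqMixin (iet R).
HB.instance Definition _ := gen_choiceMixin (iet R).
HB.instance Definition _ :=
  isGroup.Build (iet R) iet_mulA iet_mul1 iet_mulr1 iet_mulV iet_mulrV.

End IetGroup.

Section Rotations.
Variable R : realType.
Implicit Types (a : R) (x : I01 R).

Lemma rot_subproof a x :
  0 <= val x + a - (Num.floor (val x + a))%:~R < 1.
Proof.
move: (val x + a) => u; have := floor_itv u; rewrite intrD.
by rewrite subr_ge0 ltrBlDl.
Qed.

Definition rot_fun a x : I01 R := mkI01 (rot_subproof a x).

Lemma rot_funK a : cancel (rot_fun a) (rot_fun (- a)).
Proof.
move=> x; apply: val_inj => /=.
set z := Num.floor (val x + a).
have -> : val x + a - z%:~R - a = val x + (- z)%:~R by rewrite intrN; lra.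
suff -> : Num.floor (val x + (- z)%:~R) = - z by exact: addrK.
apply: floor_def; rewrite intrD.
have /andP[x0 x1] := valP x; move: (val x) x0 x1 => u u0 u1.
by rewrite lerDr u0 [ltLHS]addrC ltrD2l.
Qed.

Lemma is_iet_rot a : is_iet (rot_fun a).
Proof.
have [t [aE t0 t1]] : exists t : R,
    [/\ a = (Num.floor a)%:~R + t, 0 <= t & t < 1].
  exists (a - (Num.floor a)%:~R); have := floor_itv a; rewrite intrD.
  by move=> /andP[? ?]; split; lra.
apply: (@is_iet_fin R bool (fun i => if i then 0 else 1 - t)
  (fun i => if i then 1 - t else 1) (fun i => if i then t else t - 1)).
- exists (rot_fun (- a)); first exact: rot_funK.
  by move=> x; rewrite -{1}(opprK a) rot_funK.
- by case=> _; split; lra.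
- move=> x; case/andP: (valP x) => x0 x1.
  have [xt|xt] := ltP (val x) (1 - t).
    by exists true; split; [apply/andP|case=> // /andP[]; lra].
  by exists false; split; [apply/andP|case=> // /andP[]; lra].
- move=> i x xi; rewrite [LHS]/= -[sval x]/(val x).
  case/andP: (valP x) => x0 x1.
  suff -> : Num.floor (val x + a) = Num.floor a + (if i then 0 else 1).
    by rewrite intrD {1}aE; case: i {xi}; lra.
  apply: floor_def; rewrite !intrD {2 3}aE.
  move: (val x) x0 x1 xi => u.
  by case: i => u0 u1 /andP[? ?]; apply/andP; split; lra.
Qed.

(* The rotation R_a; it depends only on the class of a in R/Z. *)
Definition rot a : iet R := Iet (is_iet_rot a).

End Rotations.

(* Permutations of {1, .., q} are elements of 'S_q: the point k of {1, .., q}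
   is the element k - 1 of 'I_q. *)

(* t as a map on nat, fixing every k >= q *)
Definition perm_nat (q : nat) (t : 'S_q) (k : nat) : nat :=
  if insub k is Some i then val (t i) else k.

Lemma perm_natE (q : nat) (t : 'S_q) (i : 'I_q) : perm_nat t i = t i.
Proof. by rewrite /perm_nat valK. Qed.

Lemma perm_natK (q : nat) (t : 'S_q) :
  cancel (perm_nat t) (perm_nat (t^-1)%g).
Proof.
move=> k; rewrite {2}/perm_nat; case: insubP => [i _ <-|nk].
  by rewrite perm_natE permK.
by rewrite /perm_nat insubN.
Qed.

Lemma perm_nat_lt (q : nat) (t : 'S_q) (k : nat) :
  (k < q)%N -> (perm_nat t k < q)%N.
Proof. by move=> kq; rewrite -[k]/(val (Ordinal kq)) perm_natE. Qed.

Section IntervalPermutations.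
Variables (R : realType) (q : nat).
Implicit Types (t : 'S_q) (x : I01 R).

(* The (0-based) index k of the interval [k / q, (k + 1) / q[ containing x. *)
Definition piece x : nat := Num.truncn (q%:R * val x).

Lemma pieceP x k : (0 < q)%N ->
  (k%:R / q%:R <= val x < k.+1%:R / q%:R) <-> piece x = k.
Proof.
move=> q0; have q0' : 0 < q%:R :> R by rewrite ltr0n.
rewrite ler_pdivrMr // ltr_pdivlMr // ![val x * _]mulrC; split.
  by move=> h; apply/eqP; rewrite /piece truncn_eq // mulr_ge0 ?ler0n //;
    case/andP: (valP x).
move=> <-; apply: truncn_itv.
by rewrite mulr_ge0 ?ler0n //; case/andP: (valP x).
Qed.

Lemma piece_lt x : (0 < q)%N -> (piece x < q)%N.
Proof.
move=> q0; have q0' : 0 < q%:R :> R by rewrite ltr0n.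
have /(pieceP x _ q0)/andP[h _] := erefl (piece x).
rewrite -(ltr_nat R) -[q%:R]mul1r -ltr_pdivrMr //.
by apply: le_lt_trans h _; case/andP: (valP x).
Qed.

Lemma Etau_itv t x : (0 < q)%N ->
  (perm_nat t (piece x))%:R / q%:R <=
  val x + ((perm_nat t (piece x))%:R - (piece x)%:R) / q%:R <
  (perm_nat t (piece x)).+1%:R / q%:R.
Proof.
move=> q0; have /(pieceP x _ q0) := erefl (piece x).
rewrite -!natr1 !mulrDl mulNr.
by move=> /andP[? ?]; apply/andP; split; lra.
Qed.

Lemma Etau_subproof t x :
  0 <= val x + ((perm_nat t (piece x))%:R - (piece x)%:R) / q%:R < 1.
Proof.
have [q0|q0] := posnP q.
  have -> : (q%:R : R) = 0 by rewrite q0.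
  by rewrite invr0 mulr0 addr0; exact: (valP x).
have q0' : 0 < q%:R :> R by rewrite ltr0n.
have /andP[h1 h2] := Etau_itv t x q0; apply/andP; split.
  by apply: le_trans h1; rewrite divr_ge0 ?ler0n.
apply: lt_le_trans h2 _; rewrite ler_pdivrMr // mul1r ler_nat.
exact/perm_nat_lt/piece_lt.
Qed.

Definition Etau_fun t x : I01 R := mkI01 (Etau_subproof t x).

Lemma val_Etau t x :
  val (Etau_fun t x) =
  val x + ((perm_nat t (piece x))%:R - (piece x)%:R) / q%:R.
Proof. by []. Qed.

Lemma piece_Etau t x : (0 < q)%N ->
  piece (Etau_fun t x) = perm_nat t (piece x).
Proof. by move=> q0; apply/(pieceP _ _ q0); exact: Etau_itv. Qed.

Lemma Etau_funK t : cancel (Etau_fun t) (Etau_fun (t^-1)%g).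
Proof.
move=> x; apply: val_inj; rewrite !val_Etau.
have [q0|q0] := posnP q.
  have -> : (q%:R : R) = 0 by rewrite q0.
  by rewrite invr0 !mulr0 !addr0.
rewrite piece_Etau // perm_natK.
by rewrite -addrA -mulrDl addrA subrK subrr mul0r addr0.
Qed.

Lemma is_iet_Etau t : is_iet (Etau_fun t).
Proof.
have bij : bijective (Etau_fun t).
  exists (Etau_fun (t^-1)%g); first exact: Etau_funK.
  by move=> x; rewrite -{1}(invgK t) Etau_funK.
have [q0|q0] := posnP q.
  suff -> : Etau_fun t = id by exact: is_iet_id.
  apply/funext => x; apply: val_inj; rewrite val_Etau.
  have -> : (q%:R : R) = 0 by rewrite q0.
  by rewrite invr0 mulr0 addr0.
have q0' : 0 < q%:R :> R by rewrite ltr0n.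
apply: (@is_iet_fin R 'I_q (fun i => i%:R / q%:R) (fun i => i.+1%:R / q%:R)
  (fun i => ((t i)%:R - i%:R) / q%:R)) => //.
- move=> i _; split; first by rewrite divr_ge0 ?ler0n.
  by rewrite ler_pdivrMr // mul1r ler_nat.
- move=> x; exists (Ordinal (piece_lt x q0)); split; first exact/pieceP.
  by move=> i /(pieceP _ _ q0) xi; apply: val_inj.
- by move=> i x /(pieceP _ _ q0) /= ->; rewrite perm_natE.
Qed.

Definition Etau t : iet R := Iet (is_iet_Etau t).

Definition G1q : set (iet R) := range Etau.

(* For Q in G_{1/q}: the image of Q under the isomorphism E_tau |-> tau. *)
Definition frakS (Q : set (iet R)) : set 'S_q := [set t | Q (Etau t)].

Lemma EtauM t u : (0 < q)%N -> Etau (t * u)%g = (Etau t * Etau u)%g.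
Proof.
move=> q0; apply: iet_ext => x; apply: val_inj.
rewrite -[RHS]/(val (Etau_fun u (Etau_fun t x))) !val_Etau piece_Etau //.
have -> : perm_nat (t * u)%g (piece x) = perm_nat u (perm_nat t (piece x)).
  have := piece_lt x q0; move: (piece x) => k kq.
  by rewrite -[k]/(val (Ordinal kq)) !perm_natE permM.
by rewrite -addrA -mulrDl; congr (_ + _ / _); rewrite [RHS]addrC subrKA.
Qed.

End IntervalPermutations.

(* The q-cycle (1, 2, .., q). *)
Definition sigma (q : nat) : 'S_q := perm (@ordS_inj q).

Section ExtendPermutation.
Variables (p q : nat) (lepq : (p <= q)%N).

Definition ext_fun (t : 'S_p) (i : 'I_q) : 'I_q :=
  if insub (val i) is Some j then widen_ord lepq (t j) else i.

Lemma ext_funE t i : ext_fun t i = perm_nat t i :> nat.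
Proof. by rewrite /ext_fun /perm_nat; case: insub. Qed.

Lemma ext_fun_inj t : injective (ext_fun t).
Proof.
move=> i j ij; apply/val_inj/(can_inj (perm_natK t)).
by rewrite -!ext_funE ij.
Qed.

Definition ext_perm (t : 'S_p) : 'S_q := perm (@ext_fun_inj t).

End ExtendPermutation.

Lemma leq_exp2S (n : nat) : (2 ^ n <= 2 ^ n.+1)%N.
Proof. by rewrite leq_exp2l. Qed.

Section Tower.
Variable n : nat.
Local Open Scope group_scope.

Definition tau : 'S_(2 ^ n.+1) := sigma (2 ^ n.+1) ^+ (2 ^ n).

Definition Pi1 : 'S_(2 ^ n.+1) := ext_perm (leq_exp2S n) (sigma (2 ^ n)).

Definition tower_step (G : {set 'S_(2 ^ n)}) : {set 'S_(2 ^ n.+1)} :=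
  let L := ext_perm (leq_exp2S n) @: G in (L \x (L :^ tau)) ><| <[tau]>.

End Tower.

(* is_calG G: G is the group G_{2^n} (n >= 1), built with some choice of the
   successive conjugating permutations. Since products of permutations are read
   from left to right, the composite "first Pi_1, then tau" is Pi1 * tau. *)
Inductive is_calG : forall n : nat, {set 'S_(2 ^ n)} -> Prop :=
| is_calG_base : @is_calG 1 [set: 'S_(2 ^ 1)]%SET
| is_calG_step (n : nat) (K : {set 'S_(2 ^ n)}) (p : 'S_(2 ^ n.+1)) :
    is_calG K ->
    ((Pi1 n * tau n) ^ p)%g = sigma (2 ^ n.+1) ->
    @is_calG n.+1 (tower_step K :^ p)%g.

(* Sanity check: a G such that is_calG G exists and is a group, so that in
   particular the internal products in tower_step are never degenerate. *)
Section TowerTheory.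
Local Open Scope nat_scope.

Lemma sigmaE q (i : 'I_q) : val (sigma q i) = if i.+1 < q then i.+1 else 0.
Proof.
rewrite permE /=; case: ltnP => h; first by rewrite modn_small.
have iq := ltn_ord i; have e : i.+1 = q by lia.
by rewrite e modnn.
Qed.

Lemma sigmaXE q (i : 'I_q) k : val ((sigma q ^+ k)%g i) = (i + k) %% q.
Proof.
elim: k => [|k IH]; first by rewrite expg0 perm1 addn0 modn_small.
by rewrite expgSr permM permE /= IH -addn1 modnDml addn1 addnS.
Qed.

Lemma tauE n (i : 'I_(2 ^ n.+1)) :
  val (tau n i) = if i < 2 ^ n then i + 2 ^ n else i - 2 ^ n.
Proof.
rewrite sigmaXE; move: (ltn_ord i); move: (nat_of_ord i) => {}i.
rewrite expnS => lti; case: ltnP => h; first by rewrite modn_small //; lia.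
have -> : i + 2 ^ n = (i - 2 ^ n) + 2 * 2 ^ n by lia.
by rewrite modnDr modn_small; lia.
Qed.

Lemma ext_permE p q (h : p <= q) (t : 'S_p) (i : 'I_q) :
  val (ext_perm h t i) = perm_nat t i.
Proof. by rewrite permE -(ext_funE h). Qed.

Lemma ext_permM p q (h : p <= q) : {morph ext_perm h : t u / (t * u)%g}.
Proof.
move=> t u; apply/permP => i; apply/val_inj.
rewrite permM !ext_permE {1 3}/perm_nat; case: insubP => [j _ _|ni].
  by rewrite permM perm_natE.
by rewrite /perm_nat insubN.
Qed.

Lemma Pi1E n (i : 'I_(2 ^ n.+1)) : val (Pi1 n i) =
  if i < 2 ^ n then (if i.+1 < 2 ^ n then i.+1 else 0) else i.
Proof.
rewrite ext_permE /perm_nat; case: insubP => [j jN ji|/negPf-> //].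
by rewrite jN sigmaE ji.
Qed.

Lemma calG_conjugator n :
  exists p : 'S_(2 ^ n.+1), ((Pi1 n * tau n) ^ p)%g = sigma (2 ^ n.+1).
Proof.
pose N := 2 ^ n; have N0 : 0 < N by rewrite expn_gt0.
have NE : 2 ^ n.+1 = 2 * N by rewrite expnS.
pose f x := if x < N then 2 * x else
            if x == N then 2 * N - 1 else 2 * x - 2 * N - 1.
have oN (i : 'I_(2 ^ n.+1)) : i < 2 * N by rewrite -NE.
have fP (i : 'I_(2 ^ n.+1)) : f i < 2 ^ n.+1.
  have := oN i; move: (nat_of_ord i) => k; rewrite /f NE.
  by case: (ltnP k N) => h1; [lia|case: (eqVneq k N) => h2; lia].
have finj : injective (fun i => Ordinal (fP i)).
  move=> i j /(congr1 val) /= ij; apply: val_inj => /=.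
  have := oN i; have := oN j.
  move: ij; rewrite /f.
  move: (nat_of_ord i) (nat_of_ord j) => k l.
  by case: (ltnP k N) => ?; case: (ltnP l N) => ?;
     case: (eqVneq k N) => ?; case: (eqVneq l N) => ?; lia.
exists (perm finj); apply: (mulgI (perm finj)).
rewrite /conjg mulKVg; apply/permP => i; apply/val_inj.
rewrite !permM sigmaE !(permE finj) /= tauE Pi1E.
have := oN i; move: (nat_of_ord i) => k; rewrite -/N /f NE.
move=> k2; case: (ltnP k N) => h1.
  have [h2|h2] := ltnP k.+1 N.
    rewrite h2 (_ : (k.+1 + N < N) = false); last by lia.
    rewrite (_ : (k.+1 + N == N) = false); last by lia.
    by rewrite (_ : (2 * k).+1 < 2 * N); [lia|lia].
  rewrite N0 add0n ltnn eqxx (_ : (2 * k).+1 < 2 * N); last by lia.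
  by lia.
rewrite (ltnNge k) h1 /= (_ : k - N < N); last by lia.
have [h3|h3] := eqVneq k N.
  by rewrite (_ : (2 * N - 1).+1 < 2 * N = false); lia.
by rewrite (_ : (2 * k - 2 * N - 1).+1 < 2 * N); lia.
Qed.

Lemma calG_exists n : 0 < n -> exists G : {set 'S_(2 ^ n)}, is_calG G.
Proof.
elim: n => // -[_ _|n IH _]; first by exists [set: 'S_(2 ^ 1)]%SET; constructor.
have [K KG] := IH isT; have [p pP] := calG_conjugator n.+1.
by exists (tower_step K :^ p)%g; constructor.
Qed.

Lemma tower_stepE n (K : {group 'S_(2 ^ n)}) :
  let L := ext_perm (leq_exp2S n) @: K in
  tower_step K = (L * (L :^ tau n) * <[tau n]>)%g
  /\ group_set (tower_step K) .
Proof.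
move=> L.
have Lg : group_set L.
  apply/group_setP; split.
    apply/imsetP; exists 1%g => //; apply: (mulgI (ext_perm (leq_exp2S n) 1)).
    by rewrite -ext_permM !mulg1.
  move=> x y /imsetP[t tK ->] /imsetP[u uK ->].
  by rewrite -ext_permM imset_f // groupM.
pose LG := group Lg.
set N := 2 ^ n; have oN (i : 'I_(2 ^ n.+1)) : i < 2 * N by rewrite -expnS.
have N0 : 0 < N by rewrite expn_gt0.
have NE : 2 ^ n.+1 = 2 * N by rewrite expnS.
have Lhi x (i : 'I_(2 ^ n.+1)) : x \in L -> N <= i -> x i = i.
  move=> /imsetP[t tK ->] Ni; apply: val_inj; rewrite ext_permE /perm_nat.
  by rewrite insubN // -leqNgt.
have Llo x (i : 'I_(2 ^ n.+1)) : x \in L -> i < N -> x i < N.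
  by move=> /imsetP[t tK ->] Ni; rewrite ext_permE perm_nat_lt.
have tt : (tau n * tau n = 1)%g.
  apply/permP => i; apply: val_inj; rewrite permM perm1 !tauE -/N.
  have := oN i; case: (ltnP i N) => h1 h2.
    by rewrite (_ : i + N < N = false) ?addnK //; lia.
  by rewrite (_ : i - N < N) ?subnK //; lia.
have tV : (tau n)^-1%g = tau n by apply: (mulgI (tau n)); rewrite mulgV tt.
have tlo (i : 'I_(2 ^ n.+1)) : (tau n i < N) = (N <= i).
  by rewrite tauE -/N; have := oN i; case: (ltnP i N) => ? ?; lia.
have Tlo y (i : 'I_(2 ^ n.+1)) : y \in (L :^ tau n)%g -> i < N -> y i = i.
  move=> /imsetP[x xL ->] iN; rewrite /conjg !permM tV (Lhi x) //.
    by rewrite -permM tt perm1.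
  by rewrite leqNgt tlo -ltnNge.
have Thi y (i : 'I_(2 ^ n.+1)) : y \in (L :^ tau n)%g -> N <= i -> N <= y i.
  move=> /imsetP[x xL ->] iN; rewrite /conjg !permM tV.
  by rewrite leqNgt tlo -ltnNge; apply: Llo; rewrite ?tlo.
have tI : (LG :&: (LG :^ tau n) = 1)%g.
  apply/trivgP/fintype.subsetP => x /finset.setIP[xL xT]; apply/set1P/permP => i.
  by rewrite perm1; case: (ltnP i N) => h; [apply: Tlo|apply: Lhi].
have cI : (LG :^ tau n \subset 'C(LG))%g.
  apply/centsP => y yT x xL; apply/permP => i; rewrite !permM.
  case: (ltnP i N) => h.
    by rewrite (Tlo y) // (Tlo y) // Llo.
  by rewrite (Lhi x) // ?(Lhi x) // Thi.
have dE : (LG \x (LG :^ tau n) = LG * (LG :^ tau n))%g by apply: dprodE.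
have [D DE] : exists D : {group 'S_(2 ^ n.+1)}, D = (LG * (LG :^ tau n))%g :> {set _}.
  by exists (LG <*> (LG :^ tau n))%G; exact: (cent_joinEr cI).
have nD : (<[tau n]> \subset 'N(D))%g.
  rewrite cycle_subG; apply/normP; rewrite DE conjsMg -conjsgM tt conjsg1.
  by rewrite (centC cI).
have iD : (D :&: <[tau n]> = 1)%g.
  apply/trivgP/fintype.subsetP => x /finset.setIP[]; rewrite DE => /mulsgP[a b aL bT ->].
  move=> /cycleP[k].
  have -> : (tau n ^+ k = tau n ^+ (odd k))%g.
    rewrite -{1}(odd_double_half k) expgD -muln2 mulnC expgM expgS expg1 tt.
    by rewrite expg1n mulg1.
  case: (odd k); last by move=> ->; rewrite expg0 inE.
  rewrite expg1 => /permP abt.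
  have z0 : 0 < 2 ^ n.+1 by rewrite expn_gt0.
  have := abt (Ordinal z0); rewrite permM (Tlo b) //; last exact: Llo.
  move/(congr1 (fun z : 'I__ => z < N)); rewrite /= tlo.
  by rewrite (Llo _ (Ordinal z0)) //= leqNgt N0.
have sE : tower_step K = (D * <[tau n]>)%g.
  by rewrite /tower_step -/L -[L]/(LG : {set _}) dE -DE sdprodE.
split; first by rewrite sE DE.
have -> : tower_step K = (D <*> <[tau n]>)%g by rewrite sE norm_joinEr.
exact: groupP.
Qed.

Lemma is_calG_group n (G : {set 'S_(2 ^ n)}) : is_calG G -> group_set G.
Proof.
elim=> [|k K p _ /= gK _]; first exact: groupP.
have [_ gT] := tower_stepE (group gK).
exact: (groupP (group gT :^ p)%G).
Qed.

End TowerTheory.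

Section HAQ.
Variables (R : realType) (s m : nat).

(* alpha i is a real representative of a class in R/Z: that class is not in
   Q/Z. *)
Definition irrational_mod1 (a : R) : Prop := forall r : rat, a <> ratr r.

(* A vanishing sum in R/Z is a sum of representatives that is an integer. *)
Definition Q_independent_mod1 (alpha : 'I_s -> R) : Prop :=
  forall k : 'I_s -> int,
    (exists z : int, \sum_i (k i)%:~R * alpha i = z%:~R) ->
    forall i, k i = 0.

Definition HAQ (alpha : 'I_s -> R) (g : 'I_m -> iet R) : set (iet R) :=
  gen (range (fun i => rot (alpha i)) `|` range g).

End HAQ.

(* Main.v *)
Require Import Defs.
From mathcomp Require Import all_boot all_order all_algebra all_fingroup.
From mathcomp Require Import cyclic commutator nilpotent.
From mathcomp Require Import ring lra zify.
From mathcomp Require Import boolp classical_sets functions cardinality reals.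

Set Implicit Arguments.
Unset Strict Implicit.
Unset Printing Implicit Defensive.

(** Why the result holds.

    Cut the circle into q = 2^n arcs of length 1/q.  A point x is determined
    by its offset inside its arc and by the index of the arc; the points with
    the same offset form the fibre of x, which is its orbit under the E_t with
    t a permutation of the q arcs.  An E_t keeps the offset and permutes each
    fibre by t.  A rotation R_a moves fibres to fibres, and on one fibre it
    acts on indices as a power of the q-cycle sigma (rot_Etau).  So if a group
    Gam of permutations contains sigma, the group H generated by rotations and
    by the E_t with t in Gam is a skew product over a group of rotations, and
    the elements of H that preserve every fibre act on each fibre by an element
    of Gam depending on the fibre: they lie in fibrewise Gam.

    This would only give derived length at most one more than that of Gam.  The
    extra step is saved because rotations and the E_t commute up to
    fibrewise Gam': on a fibre, the commutator of E_t and R_a acts as the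
    commutator of t and a power of sigma, an element of Gam'.  Hence H' is
    contained in fibrewise Gam' (derived_gen_sub), and then the k-th derived
    subgroup of H in fibrewise Gam^(k) for all k >= 1, since commutators of
    fibrewise maps are computed fibre by fibre.  As H contains a copy of Gam, it
    has exactly the derived length of Gam (skew_n_solvable).

    For the tower of 2-groups this length is n: each step is a wreath product
    W = (L x L^tau) : <tau>.  Its derived subgroup lies in L x L^tau, and
    modulo L^tau it covers L, so that the length grows by exactly one
    (wreath_der_trivial, wreath_der_nontrivial).  Moreover the group contains
    sigma, because Pi_1 tau lies in W before conjugation (calG_derived).

    Infinitely many groups are obtained by letting the rotations vary while Gam
    stays fixed: for a prime p > q, take all rotations by fractions i / p^j.
    The group is infinite because the R_(1/p^j) are distinct, and it contains
    R_(1/p), of order p.  It has no element of order r for another prime r > q: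
    if (k R_a)^r = 1 with k fibrewise, then q r a is an integer, which for
    a = i / p^j forces a to be an integer, so the element is k, whose order
    divides q!.  The set of primes p > q that are orders of elements thus
    recovers p from the isomorphism class. *)

Import Order.TTheory GRing.Theory Num.Theory.

Local Open Scope classical_set_scope.

(* The same identifier denotes the rotation of sequences. *)
Local Notation rot := Defs.rot.

(** * Subgroups and commutators *)

Section Subgroups.
Local Open Scope group_scope.
Variable gT : groupType.
Implicit Types (H N S : set gT) (x y z : gT).

Lemma subgroupV H x : is_subgroup H -> H x -> H x^-1.
Proof. by move=> [H1 HB] Hx; rewrite -[x^-1]mul1g; exact: HB. Qed.

Lemma subgroupM H x y : is_subgroup H -> H x -> H y -> H (x * y).
Proof.
by move=> sH Hx Hy; rewrite -[y]invgK; apply: sH.2 => //; exact: subgroupV.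
Qed.

Lemma subgroupX H x k : is_subgroup H -> H x -> H (x ^+ k).
Proof.
move=> sH Hx; elim: k => [|k IH]; first exact: sH.1.
by rewrite expgS; exact: subgroupM.
Qed.

Lemma gen_subgroup S : is_subgroup (gen S).
Proof.
split=> [A [sA _]|x y Sx Sy A HA]; first exact: sA.1.
by apply: HA.1.2; [exact: Sx|exact: Sy].
Qed.

Lemma sub_gen_set S : S `<=` gen S.
Proof. exact: sub_gen_smallest. Qed.

Lemma gen_sub S H : is_subgroup H -> S `<=` H -> gen S `<=` H.
Proof. exact: smallest_sub. Qed.

Lemma derived_sub H N : is_subgroup N ->
  (forall x y, H x -> H y -> N [~ x, y]) -> derived H `<=` N.
Proof. by move=> sN HN; apply: gen_sub => // _ [x Hx [y Hy <-]]; exact: HN. Qed.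

Lemma derived_seriesR H k x y : derived_series k H x -> derived_series k H y ->
  derived_series k.+1 H [~ x, y].
Proof. by move=> Hx Hy; apply: (@sub_gen_set); exists x => //; exists y. Qed.

Lemma commMg_conj x y z : [~ x * y, z] = [~ x, z] ^ y * [~ y, z].
Proof. by rewrite !commgEr conjgM mulgA -conjMg mulgK. Qed.

(** If the generators normalise N, then N is normalised by the whole generated
    group, and in the quotient by N the generators commute pairwise, so the
    quotient is abelian. *)
Lemma derived_gen_sub S N : is_subgroup N ->
    (forall s x, S s -> N x -> N (x ^ s) /\ N (x ^ s^-1)) ->
    (forall s t, S s -> S t -> N [~ s, t]) ->
  derived (gen S) `<=` N.
Proof.
move=> sN nN cN; apply: derived_sub => //.
pose M := [set g | forall x, N x -> N (x ^ g) /\ N (x ^ g^-1)].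
have SM : gen S `<=` M.
  apply: gen_sub; last by move=> s Ss x; exact: nN.
  split=> [x Nx|g h Mg Mh x Nx]; first by rewrite invg1 conjg1.
  rewrite invMg invgK !conjgM.
  by split; [exact: (Mh _ (Mg _ Nx).1).2|exact: (Mg _ (Mh _ Nx).1).2].
(* Centralisers modulo N are subgroups, so pairwise commutation extends from
   generators to the generated group in one argument, then in the other. *)
have commN g : gen S g -> is_subgroup [set h | gen S h /\ N [~ h, g]].
  move=> Sg; have sS := gen_subgroup S.
  split=> /= [|x y [Sx Nx] [Sy Ny]].
    by rewrite comm1g; split; [exact: sS.1|exact: sN.1].
  split; first exact: sS.2.
  rewrite commMg_conj; apply: subgroupM => //; first exact: (SM _ Sy _ Nx).2.
  suff -> : [~ y^-1, g] = [~ y, g]^-1 ^ y^-1.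
    by apply: (SM _ Sy _ _).2; exact: subgroupV.
  apply: (mulgI ([~ y, g] ^ y^-1)); rewrite -commMg_conj mulgV comm1g.
  by rewrite conjVg mulgV.
have SN s g : S s -> gen S g -> N [~ g, s].
  move=> Ss Sg; suff [] : [set h | gen S h /\ N [~ h, s]] g by [].
  move: g Sg; apply: gen_sub; first by apply: commN; exact: sub_gen_set.
  by move=> t St; split; [exact: sub_gen_set|exact: cN].
move=> g h Sg Sh.
suff [] : [set x | gen S x /\ N [~ x, h]] g by [].
move: g Sg; apply: gen_sub; first exact: commN.
move=> s Ss; split; first exact: sub_gen_set.
by rewrite -invgR; apply: subgroupV => //; exact: SN.
Qed.

End Subgroups.

(** * Torsion *)

Section Torsion.
Local Open Scope group_scope.
Variable gT : groupType.
Implicit Types (H K : set gT) (x : gT).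

(** For m prime this says that m is the order of an element of H, an isomorphism
    invariant; it tells apart the groups of the infinite family. *)
Definition has_torsion m H : Prop := exists x, [/\ H x, x <> 1 & x ^+ m = 1].

Lemma isomorphic_torsion m H K : is_subgroup H -> isomorphic H K ->
  has_torsion m H -> has_torsion m K.
Proof.
move=> sH [phi [[phiK phi_inj _] phiM]] [x [Hx x1 xm]].
have phi1 : phi 1 = 1.
  by apply: (mulgI (phi 1)); rewrite -phiM ?mulg1 //; exact: sH.1.
have phiX k : phi (x ^+ k) = phi x ^+ k.
  elim: k => [|k IH]; first by rewrite !expg0 phi1.
  by rewrite !expgS phiM ?IH //; exact: subgroupX.
exists (phi x); split; first exact: phiK.
  rewrite -phi1 => /phi_inj e; apply: x1.
  by apply: e; rewrite inE //; exact: sH.1.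
by rewrite -phiX xm phi1.
Qed.

Lemma coprime_torsion x m k : coprime m k -> x ^+ m = 1 -> x ^+ k = 1 -> x = 1.
Proof.
case: (posnP m) => [->|m0] cmk xm xk.
  by move: cmk xk; rewrite /coprime gcd0n => /eqP->; rewrite expg1.
have [u v uv _] := egcdnP k m0.
have : x ^+ (u * m) = x ^+ (v * k + gcdn m k) by rewrite uv.
rewrite (eqP cmk) addn1 expgS mulnC expgnA xm expg1n.
by rewrite mulnC expgnA xk expg1n mulg1.
Qed.

End Torsion.

(** * Derived length of the tower of 2-groups *)

Section FiniteGroups.
Local Open Scope group_scope.

Lemma derg_iterS (gT : finGroupType) (A : {set gT}) k :
  A^`(k.+1) = (A^`(1))^`(k).
Proof. by elim: k => // k IH; rewrite dergSn IH. Qed.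

(** When x has order 2, this presents W internally as the wreath product of L by
    a group of order 2. *)
Section Wreath.
Variables (gT : finGroupType) (L W : {group gT}) (x : gT).
Hypothesis WE : (L \x (L :^ x)) ><| <[x]> = W.

Lemma wreath_der1_sub (D : {group gT}) : L \x (L :^ x) = D -> W^`(1) \subset D.
Proof.
move=> DE; have [_ WM nD _] := sdprodP WE; rewrite DE in WM nD.
apply: der1_min; first by rewrite -WM mulG_subG normG.
by rewrite -WM quotientMidl quotient_abelian // cycle_abelian.
Qed.

(** As W' lies in L x L^x, the (k+1)-st derived subgroup of W is contained in
    the product of L^(k) and its conjugate by x. *)
Lemma wreath_der_trivial k : L^`(k) = 1 -> W^`(k.+1) = 1.
Proof.
move=> Lk; have [[D _ DE _] _ _ _] := sdprodP WE.
rewrite derg_iterS; apply/trivgP => /=.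
apply: fintype.subset_trans (dergS k (wreath_der1_sub DE)) _.
by rewrite -(der_dprod k DE) derJ Lk conjs1g dprodg1.
Qed.

(** Modulo L^x every y in L is the commutator of y^-1 and x.  So W' covers L
    modulo L^x, and therefore W^(k+1) covers L^(k), which meets L^x
    trivially. *)
Lemma wreath_der_nontrivial k : W^`(k.+1) = 1 -> L^`(k) = 1.
Proof.
move=> Wk; have [[D _ DE _] WM _ _] := sdprodP WE; rewrite DE in WM.
have W1D := wreath_der1_sub DE.
have [_ DM cLM tLM] := dprodP DE.
have LW : L \subset W.
  by apply: (@fintype.subset_trans _ _ D); [rewrite -DM|rewrite -WM];
    exact: mulG_subl.
have xW : x \in W by rewrite -cycle_subG -WM mulG_subr.
have nML : L \subset 'N(L :^ x) by rewrite cents_norm // centsC.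
have nMD : D \subset 'N(L :^ x) by rewrite -DM mulG_subG nML normG.
have LWM : L \subset W^`(1) * (L :^ x).
  apply/fintype.subsetP => y yL.
  have -> : y = [~ y^-1, x] * y ^ x by rewrite commgEl invgK conjVg mulgKV.
  apply: mem_mulg.
    by rewrite mem_commg // groupV (fintype.subsetP LW).
  by rewrite memJ_conjg.
have LM1 : L^`(k) / (L :^ x) = 1.
  have sLW : (L / (L :^ x))^`(k) \subset (W^`(1) / (L :^ x))^`(k).
    apply: dergS => /=; have := quotientS (L :^ x) LWM.
    by rewrite (quotientMidr (L :^ x)%G).
  rewrite quotient_der //; apply/trivgP; apply: (fintype.subset_trans sLW).
  rewrite -quotient_der ?(fintype.subset_trans W1D) //.
  by rewrite -derg_iterS Wk quotient1.
have nMk : L^`(k) \subset 'N(L :^ x).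
  exact: fintype.subset_trans (der_sub k L) nML.
apply/trivgP; rewrite -tLM finset.subsetI der_sub /=.
by rewrite -quotient_sub1 // LM1.
Qed.

End Wreath.

Definition ext_morphism p q (h : (p <= q)%N) :=
  Morphism (in2W (@ext_permM p q h) :
    {in [set: 'S_p]%SET &, {morph _ : t u / t * u}}).

Lemma ext_morphism_injm p q (h : (p <= q)%N) : 'injm (ext_morphism h).
Proof.
apply/injmP => t u _ _ /permP tu; apply/permP => i; apply: val_inj.
by have /(congr1 val) := tu (widen_ord h i); rewrite !ext_permE /= !perm_natE.
Qed.

(** Conjugating the wreath product does not change its derived length; the
    conjugating permutation only serves to make the product of Pi_1 and tau,
    which belongs to the wreath product, equal to the standard cycle. *)
Lemma calG_derived n (G : {set 'S_(2 ^ n)}) : is_calG G ->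
  [/\ (0 < n)%N, sigma (2 ^ n) \in G, G^`(n) = 1 & G^`(n.-1) <> 1].
Proof.
elim=> {n G} [|n K p KG [n0 sK Kn Kn1] pP].
  have aS : abelian [set: 'S_(2 ^ 1)]%SET.
    by apply: cyclic_abelian; apply: prime_cyclic; rewrite cardsT card_Sn.
  split=> //.
  - by rewrite inE.
  - exact: (elimT (@derG1P _ [set: 'S_(2 ^ 1)]%G) aS).
  move=> /setP/(_ (sigma 2)); rewrite !inE => /esym/eqP e.
  have := congr1 (fun t : 'S_2 => t ord0) e.
  by move/(congr1 val); rewrite perm1 sigmaE.
pose KH := group (is_calG_group KG).
have [_ gW] := tower_stepE KH.
pose L := (ext_morphism (leq_exp2S n) @* KH)%G.
have LE : ext_perm (leq_exp2S n) @: K = L.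
  by rewrite /= morphimEsub ?finset.subsetT.
have WE : (L \x (L :^ tau n)) ><| <[tau n]> = group gW by rewrite -LE.
have LD k : L^`(k) = (ext_morphism (leq_exp2S n) @* K^`(k)).
  by rewrite /= -(morphim_der _ k (finset.subsetT KH)).
have [[D _ DE _] WM _ _] := sdprodP WE; rewrite DE in WM.
split=> //.
- rewrite -pP memJ_conjg -[tower_step K]/(group gW : {set _}) -WM.
  apply: mem_mulg; last exact: cycle_id.
  have [_ <- _ _] := dprodP DE.
  rewrite -[Pi1 n]mulg1 mem_mulg ?group1 // -LE.
  exact: imset_f.
- rewrite -[tower_step K]/(group gW : {set _}) derJ.
  by rewrite (wreath_der_trivial WE) ?conjs1g // LD Kn morphim1.
- rewrite -[tower_step K]/(group gW : {set _}) derJ /= => W1.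
  apply: Kn1; apply/eqP.
  rewrite -(morphim_injm_eq1 (ext_morphism_injm (leq_exp2S n)))
    ?finset.subsetT //.
  rewrite -LD; apply/eqP/(wreath_der_nontrivial WE); rewrite prednK //.
  by apply: (conjsg_inj (x := p)); rewrite W1 conjs1g.
Qed.

End FiniteGroups.

(** * Rotations *)

Section RotationGroup.
Variable R : realType.
Implicit Types (a b : R) (x y : I01 R).
Local Open Scope ring_scope.

Lemma int_lt1 (z : int) : -1 < (z%:~R : R) < 1 -> z = 0.
Proof.
by rewrite -[1 in X in _ && X]/(1%:~R) -[-1]/((-1)%:~R) !ltr_int; lia.
Qed.

(** Identities between exchanges of [0, 1[ are checked in R / Z: this avoids any
    case distinction on integer parts. *)
Lemma I01_eq x y (z : int) : val x = val y + z%:~R -> x = y.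
Proof.
move=> xyz; apply: val_inj; rewrite xyz.
have /andP[x0 x1] := valP x; have /andP[y0 y1] := valP y.
suff -> : z = 0 by rewrite addr0.
by apply: int_lt1; move: x0 x1; rewrite xyz => x0 x1; apply/andP; split; lra.
Qed.

Lemma rotE a x : exists z : int, val (rot a x) = val x + a + z%:~R.
Proof.
exists (- Num.floor (val x + a)); rewrite intrN; exact: erefl.
Qed.

Lemma rotD a b : rot (a + b) = (rot a * rot b)%g.
Proof.
apply: iet_ext => x.
have [z1 e1] := rotE (a + b) x; have [z2 e2] := rotE a x.
have [z3 e3] := rotE b (rot a x).
apply: (@I01_eq _ _ (z1 - z2 - z3)).
rewrite e1 -[(rot a * rot b)%g x]/(rot b (rot a x)) e3 e2 !intrB; lra.
Qed.

Lemma rot_int (z : int) : rot z%:~R = 1%g :> iet R.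
Proof.
apply: iet_ext => x; have [z1 e1] := rotE z%:~R x.
by apply: (@I01_eq _ _ (z + z1)); rewrite e1 intrD addrA.
Qed.

Lemma rot_eq1 a : rot a = 1%g -> exists z : int, a = z%:~R.
Proof.
have x01 : 0 <= (0 : R) < 1 by rewrite lexx ltr01.
move=> a1; have [z ez] := rotE a (mkI01 x01); exists (- z).
by move: ez; rewrite a1 /= intrN; lra.
Qed.

Lemma rotN a : rot (- a) = (rot a)^-1%g.
Proof.
by apply: (mulgI (rot a)); rewrite -rotD subrr mulgV (rot_int 0).
Qed.

Lemma rotX a k : (rot a ^+ k)%g = rot (a *+ k).
Proof.
elim: k => [|k IH]; first by rewrite expg0 (rot_int 0).
by rewrite expgS IH mulrS rotD.
Qed.

End RotationGroup.

Lemma iet_invK (R : realType) (f : iet R) x : f^-1%g (f x) = x.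
Proof. exact: iet_invfunK. Qed.

Lemma iet_invKV (R : realType) (f : iet R) x : f (f^-1%g x) = x.
Proof. exact: iet_invfunKV. Qed.

(** * Fibrewise permutations *)

(** The fibre of x, i.e. the set of points with the same offset as x in the
    partition into q arcs, is parametrised here as the orbit of x under the
    E_u, u in 'S_q; this makes most of the arguments purely algebraic. *)
Section Fibres.
Variables (R : realType) (q : nat).
Hypothesis q_gt0 : (0 < q)%N.
Implicit Types (x : I01 R) (f g : iet R) (t u : 'S_q) (a : R).
Implicit Types (Gam Lam : {group 'S_q}).
Local Notation E := (@Etau R q).
Local Open Scope group_scope.

Lemma Etau1 : E 1 = 1.
Proof. by apply: (mulgI (E 1)); rewrite -EtauM // !mulg1. Qed.

Lemma EtauV t : E t^-1 = (E t)^-1.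
Proof. by apply: (mulgI (E t)); rewrite -EtauM // !mulgV Etau1. Qed.

Lemma EtauR t u : E [~ t, u] = [~ E t, E u].
Proof. by rewrite !commgEl !conjgE !EtauM // !EtauV. Qed.

Lemma EtauME t u x : E u (E t x) = E (t * u) x.
Proof. by rewrite EtauM. Qed.

Lemma EtauE t x (i : 'I_q) : piece q x = i :> nat ->
  val (E t x) = (val x + ((t i)%:R - i%:R) / q%:R)%R.
Proof.
move=> xi; rewrite -perm_natE -xi; exact: val_Etau.
Qed.

Definition piece_ord x : 'I_q := Ordinal (piece_lt x q_gt0).

Lemma piece_surj (i : 'I_q) : exists x : I01 R, piece q x = i.
Proof.
have x01 : (0 <= (i%:R / q%:R : R) < 1)%R.
  by rewrite divr_ge0 ?ler0n //= ltr_pdivrMr ?ltr0n // mul1r ltr_nat.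
exists (mkI01 x01); apply/pieceP => //=.
by rewrite lexx ltr_pM2r ?invr_gt0 ?ltr0n // ltr_nat /=.
Qed.

Lemma Etau_inj : injective E.
Proof.
move=> t u tu; apply/permP => i; apply: val_inj.
have [x xi] := piece_surj i; have := EtauE t xi; rewrite tu (EtauE u xi).
move/addrI/(mulIf _) => /=; rewrite invr_eq0 pnatr_eq0 -lt0n => /(_ q_gt0).
by move/addIr/eqP; rewrite eqr_nat => /eqP.
Qed.

(** The rotation R_a adds a constant k modulo q to the indices of the points of
    the fibre of x, where k is read off from x itself: it must bring the index
    i of x to the index j of R_a x. Hence s = sigma^k. *)
Lemma rot_Etau a x : exists2 s, s \in <[sigma q]> &
  forall u, rot a (E u x) = E (u ^ s) (rot a x).
Proof.
pose i := piece_ord x; pose j := piece_ord (rot a x).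
(* j - i modulo q, avoiding truncated subtraction *)
pose k := (j + (q - i))%N.
exists (sigma q ^+ k); first exact: mem_cycle.
move=> u; have si : (sigma q ^+ k) i = j.
  apply: val_inj; rewrite sigmaXE /k addnCA subnKC 1?ltnW //.
  by rewrite addnC modnDl modn_small.
rewrite -(permK (sigma q ^+ k) i) in si.
have [z ez] := rotE a (E u x); have [z' ez'] := rotE a x.
have uj : (u ^ (sigma q ^+ k)) j = (sigma q ^+ k) (u i).
  by rewrite conjgE !permM -si !permK.
have := sigmaXE (u i) k.
rewrite -[val _]/(nat_of_ord _); set v := nat_of_ord _ => vE.
have [d dE] : exists d : int, (v%:R = (u i)%:R + k%:R + (q%:R * d%:~R) :> R)%R.
  exists (- ((u i + k) %/ q)%:Z)%R.
  have /(congr1 (fun p => p%:R : R)%R) := divn_eq (u i + k) q.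
  rewrite -vE !natrD natrM intrN => ->.
  rewrite -pmulrn; ring.
have iE : piece q x = i by [].
have jE : piece q (rot a x) = j by [].
have q0 : (q%:R != 0 :> R)%R by rewrite pnatr_eq0 -lt0n.
(* The 1 comes from the summand q of k, and d from its reduction modulo q. *)
apply: (@I01_eq _ _ _ (z - z' - d - 1)%R).
rewrite ez (EtauE u iE) (EtauE _ jE) uj ez' -/v dE.
rewrite /k natrD natrB 1?ltnW // !intrB.
set U : R := (nat_of_ord (u i))%:R%R; set I : R := (nat_of_ord i)%:R%R.
set J : R := (nat_of_ord j)%:R%R.
have -> : ((U + (J + (q%:R - I)) + q%:R * d%:~R - J) / q%:R =
           (U - I) / q%:R + 1 + d%:~R :> R)%R by field.
lra.
Qed.

Definition acts_at f x t : Prop := forall u, f (E u x) = E t (E u x).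

Definition fibrewise (Lam : {set 'S_q}) : set (iet R) :=
  [set f | forall x, exists2 t, t \in Lam & acts_at f x t].

Lemma acts_at1 x : acts_at 1 x 1.
Proof. by move=> u; rewrite Etau1. Qed.

Lemma acts_atM f g x t u : acts_at f x t -> acts_at g x u ->
  acts_at (f * g) x (t * u).
Proof.
by move=> ft gu v; rewrite -[LHS]/(g (f _)) ft EtauME gu -!EtauME.
Qed.

Lemma acts_atV f x t : acts_at f x t -> acts_at f^-1 x t^-1.
Proof.
move=> ft u; have := ft (u * t^-1).
by rewrite !EtauME mulgKV => <-; rewrite iet_invK.
Qed.

Lemma acts_atX f x t k : acts_at f x t -> acts_at (f ^+ k) x (t ^+ k).
Proof.
move=> ft; elim: k => [|k IH]; first exact: acts_at1.
by rewrite !expgS; exact: acts_atM.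
Qed.

Lemma acts_atR f g x t u : acts_at f x t -> acts_at g x u ->
  acts_at [~ f, g] x [~ t, u].
Proof.
move=> ft gu; rewrite !commgEl !conjgE.
by do !apply: acts_atM => //; exact: acts_atV.
Qed.

Lemma acts_at_inj f g x t : acts_at f x t -> acts_at g x t -> f x = g x.
Proof.
by move=> /(_ 1) ft /(_ 1) gt; move: ft; rewrite -gt Etau1.
Qed.

Lemma fibrewise_subgroup Lam : is_subgroup (fibrewise Lam).
Proof.
split=> [x|f g fL gL x]; first by exists 1 => //; exact: acts_at1.
have [t tL ft] := fL x; have [u uL gu] := gL x.
exists (t * u^-1); first by rewrite groupM ?groupV.
by apply: acts_atM => //; exact: acts_atV.
Qed.

Lemma Etau_fibrewise Lam t : t \in Lam -> fibrewise Lam (E t).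
Proof. by move=> tL x; exists t. Qed.

Lemma fibrewise1 : fibrewise [1]%G = [set 1].
Proof.
apply/seteqP; split=> [f f1|_ -> x]; last first.
  by exists 1; rewrite ?inE //; exact: acts_at1.
apply: iet_ext => x; have [t /set1P-> ft] := f1 x.
exact: acts_at_inj ft (acts_at1 x).
Qed.

Lemma derived_fibrewise Lam : derived (fibrewise Lam) `<=` fibrewise Lam^`(1)%G.
Proof.
apply: derived_sub; first exact: fibrewise_subgroup.
move=> f g fL gL x; have [t tL ft] := fL x; have [u uL gu] := gL x.
by exists [~ t, u]; [exact: mem_commg|exact: acts_atR].
Qed.

(** R_a transports the fibre of x to that of R_a x and relabels it by s. *)
Lemma acts_at_conj_rot f a x t s :
    (forall u, rot a (E u x) = E (u ^ s) (rot a x)) -> acts_at f x t ->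
  acts_at (f ^ rot a) (rot a x) (t ^ s).
Proof.
move=> as_ ft u.
have e : E u (rot a x) = rot a (E (u ^ s^-1) x) by rewrite as_ conjgKV.
rewrite e conjgE -[LHS]/(rot a (f ((rot a)^-1 (rot a _)))).
by rewrite iet_invK ft EtauME !as_ conjMg EtauME.
Qed.

Section Normalising.
Variables (Gam Lam : {group 'S_q}).
Hypotheses (sG : sigma q \in Gam) (nLam : Gam \subset 'N(Lam)).

Lemma memJ_sigma s t : s \in <[sigma q]> -> t \in Lam -> t ^ s \in Lam.
Proof.
move=> ss tL; rewrite memJ_norm // (fintype.subsetP nLam) //.
by apply: (fintype.subsetP _ _ ss); rewrite cycle_subG.
Qed.

Lemma fibrewiseJ_rot a f : fibrewise Lam f -> fibrewise Lam (f ^ rot a).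
Proof.
move=> fL y; rewrite -(iet_invKV (rot a) y); set x := (rot a)^-1 y.
have [s ss as_] := rot_Etau a x; have [t tL ft] := fL x.
by exists (t ^ s); [exact: memJ_sigma|exact: acts_at_conj_rot].
Qed.

Lemma fibrewiseJ_Etau t f : t \in Gam -> fibrewise Lam f ->
  fibrewise Lam (f ^ E t).
Proof.
move=> tG fL x; have [u uL fu] := fL x.
exists (u ^ t); first by rewrite memJ_norm // (fintype.subsetP nLam).
rewrite !conjgE; do !apply: acts_atM => //.
by apply: acts_atV.
Qed.

End Normalising.

(** * Derived length of a skew product *)

Section SkewProduct.
Variable Gam : {group 'S_q}.
Hypothesis sG : sigma q \in Gam.

(** Conjugating t by the power s of sigma by which R_a acts on a fibre changes t
    by the commutator of t and s only. This is what prevents the rotations from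
    adding one to the derived length. *)
Lemma comm_Etau_rot t a : t \in Gam -> fibrewise Gam^`(1)%G [~ E t, rot a].
Proof.
move=> tG y; rewrite -(iet_invKV (rot a) y); set x := (rot a)^-1 y.
have [s ss as_] := rot_Etau a x.
exists [~ t, s].
  apply: mem_commg => //.
  by apply: (fintype.subsetP _ _ ss); rewrite cycle_subG.
rewrite !commgEl; apply: acts_atM; first by apply: acts_atV.
exact: acts_at_conj_rot.
Qed.

Variable S : set (iet R).
Hypothesis SE : forall f, S f ->
  (exists a, f = rot a) \/ (exists2 t, t \in Gam & f = E t).

Lemma derived_skew_sub k :
  derived_series k.+1 (gen S) `<=` fibrewise Gam^`(k.+1)%G.
Proof.
elim: k => [|k IH].
  have nG := der_norm 1 Gam.
  apply: derived_gen_sub; first exact: fibrewise_subgroup.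
    move=> f h /SE[[a ->]|[t tG ->]] hG.
      by rewrite -rotN; split; exact: (fibrewiseJ_rot sG nG).
    rewrite -EtauV; split; apply: (fibrewiseJ_Etau nG) hG => //.
    by rewrite groupV.
  move=> f h /SE[[a ->]|[t tG ->]] /SE[[b ->]|[u uG ->]].
  - have /commgP/eqP -> : commute (rot a) (rot b).
      by rewrite /commute -!rotD addrC.
    exact: (fibrewise_subgroup _).1.
  - rewrite -invgR; apply: (subgroupV (fibrewise_subgroup _)).
    exact: comm_Etau_rot.
  - exact: comm_Etau_rot.
  - by rewrite -EtauR; apply: Etau_fibrewise; exact: mem_commg.
apply: subset_trans (@derived_fibrewise (Gam^`(k.+1))%G).
apply: derived_sub; first exact: gen_subgroup.
move=> f g fk gk; apply: sub_gen_set; exists f; first exact: IH.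
by exists g; first exact: IH.
Qed.

Hypothesis ES : forall t, t \in Gam -> gen S (E t).

Lemma group_set_Etau (H : set (iet R)) : is_subgroup H ->
  group_set [set u : 'S_q | `[< H (E u) >]]%SET.
Proof.
move=> sH; apply/group_setP; split.
  by rewrite inE Etau1; apply/asboolT/sH.1.
by move=> u v; rewrite !inE EtauM //; exact: subgroupM.
Qed.

Lemma derived_skew_sup k t : t \in Gam^`(k) -> derived_series k (gen S) (E t).
Proof.
elim: k t => [|k IH] t; first exact: ES.
have gD := group_set_Etau
  (gen_subgroup _ : is_subgroup (derived_series k.+1 (gen S))).
suff : Gam^`(k.+1) \subset group gD.
  by move=> /fintype.subsetP/[apply]; rewrite inE asboolE.
rewrite gen_subG; apply/fintype.subsetP => _ /imset2P[u v uk vk ->].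
rewrite inE EtauR; apply/asboolP; exact (derived_seriesR (IH _ uk) (IH _ vk)).
Qed.

Lemma skew_n_solvable n : (0 < n)%N -> Gam^`(n) = 1 -> Gam^`(n.-1) <> 1 ->
  n_solvable n (gen S).
Proof.
case: n => // n _ Gn Gn1; split=> //.
  apply/seteqP; split=> [f /derived_skew_sub|_ ->]; last first.
    exact: (gen_subgroup _).1.
  by have -> : (Gam^`(n.+1))%G = [1]%G by [apply: val_inj]; rewrite fibrewise1.
move=> D1; apply: Gn1; apply/trivgP/fintype.subsetP => t /derived_skew_sup.
by rewrite D1 => /= Et1; apply/set1P; apply: Etau_inj; rewrite Etau1.
Qed.

End SkewProduct.

(** * Elements of finite order in a skew product *)

Lemma fibrewise_rot Gam a : fibrewise Gam (rot a) ->
  exists z : int, (q%:R * a = z%:~R)%R.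
Proof.
have [x _] := piece_surj (Ordinal q_gt0).
move=> /(_ x)[t _ /(_ 1)]; rewrite Etau1 -[(1 : iet R) x]/x.
pose i := piece_ord x; have xi : piece q x = i by [].
have [z ez] := rotE a x => /(congr1 val); rewrite ez (EtauE t xi) => e.
exists ((t i)%:Z - i%:Z - q%:Z * z)%R.
have q0 : (q%:R != 0 :> R)%R by rewrite pnatr_eq0 -lt0n.
rewrite !intrB intrM -!pmulrn.
have -> : a = (((t i)%:R - i%:R) / q%:R - z%:~R)%R by lra.
by field.
Qed.

Lemma fibrewise_exp Gam f : fibrewise Gam f -> f ^+ q`! = 1.
Proof.
move=> fG; apply: iet_ext => x; have [t _ ft] := fG x.
apply: acts_at_inj (acts_at1 x).
have -> : 1 = t ^+ q`!.
  by rewrite -card_Sn -cardsT; apply/esym/expg_cardG; rewrite inE.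
exact: acts_atX.
Qed.

Section Decomposition.
Variables (Gam : {group 'S_q}) (A : set R) (S : set (iet R)).
Hypotheses (sG : sigma q \in Gam) (A0 : A 0%R).
Hypothesis AB : forall a b, A a -> A b -> A (a - b)%R.
Hypothesis SE : forall f, S f ->
  (exists2 a, A a & f = rot a) \/ (exists2 t, t \in Gam & f = E t).

Lemma fibrewise_rotK k a : fibrewise Gam k ->
  exists2 k', fibrewise Gam k' & rot a * k = k' * rot a.
Proof.
move=> kG; exists (k ^ rot (- a)%R).
  exact: (fibrewiseJ_rot sG (normG Gam)).
by rewrite rotN conjgE invgK !mulgA mulgKV.
Qed.

(** As rotations normalise the fibrewise maps, the products of a fibrewise map
    and a rotation by an element of A already form a group. *)
Lemma skew_decomposition f : gen S f ->
  exists2 a, A a & exists2 k, fibrewise Gam k & f = k * rot a.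
Proof.
have sF := fibrewise_subgroup Gam.
move: f; apply: gen_sub.
  split.
    by exists 0%R => //; exists 1; [exact: sF.1|rewrite mul1g (rot_int _ 0)].
  move=> _ _ [a Aa [k kG ->]] [b Ab [l lG ->]].
  exists (a - b)%R; first exact: AB.
  have [l' lG' e] := fibrewise_rotK (a - b) (subgroupV sF lG).
  exists (k * l'); first exact: (subgroupM sF kG lG').
  by rewrite -[RHS]mulgA -e invMg -rotN !mulgA -(mulgA k (rot a)) -rotD.
move=> f /SE[[a Aa ->]|[t tG ->]].
  by exists a => //; exists 1; [exact: sF.1|rewrite mul1g].
exists 0%R => //; exists (E t); first exact: Etau_fibrewise.
by rewrite (rot_int _ 0) mulg1.
Qed.

Lemma fibrewise_mul_rotX k a m : fibrewise Gam k ->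
  exists2 k', fibrewise Gam k' & (k * rot a) ^+ m = k' * rot (a *+ m)%R.
Proof.
have sF := fibrewise_subgroup Gam => kG.
elim: m => [|m [l lG e]].
  by exists 1; [exact: sF.1|rewrite expg0 mulr0n (rot_int _ 0) mulg1].
have [l' lG' e'] := fibrewise_rotK a lG.
exists (k * l'); first exact: (subgroupM sF kG lG').
by rewrite expgS e mulrS rotD -!mulgA (mulgA (rot a)) e' !mulgA.
Qed.

(** If k R_a has order dividing m, then R_(m a) is fibrewise, i.e. it preserves
    the offsets, so m a is a multiple of 1 / q. *)
Lemma skew_torsion f m : gen S f -> f ^+ m = 1 ->
  exists a, exists2 k, [/\ A a, fibrewise Gam k & f = k * rot a] &
    exists z : int, (q%:R * (a *+ m) = z%:~R)%R.
Proof.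
move=> /skew_decomposition[a Aa [k kG ->]] fm.
exists a, k => //; have [k' kG' e] := fibrewise_mul_rotX a m kG.
apply: (@fibrewise_rot Gam).
have -> : rot (a *+ m)%R = k'^-1 by apply: (mulgI k'); rewrite mulgV -e.
exact: subgroupV (fibrewise_subgroup _) kG'.
Qed.

End Decomposition.

End Fibres.

(** * Infinitely many non-isomorphic groups *)

Fixpoint primes_above (m k : nat) : nat :=
  s2val (prime_above (if k is k'.+1 then primes_above m k' else m)).

Lemma primes_above_prime m k : prime (primes_above m k).
Proof. by case: k => [|k] /=; case: prime_above. Qed.

Lemma primes_aboveS m k : (primes_above m k < primes_above m k.+1)%N.
Proof. by rewrite /=; case: prime_above. Qed.

Lemma primes_above_gt m k : (m < primes_above m k)%N.
Proof.
elim: k => [|k IH]; first by rewrite /=; case: prime_above.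
exact: ltn_trans IH (primes_aboveS m k).
Qed.

Lemma primes_above_inj m : injective (primes_above m).
Proof.
have mono := homo_ltn ltn_trans (primes_aboveS m).
by move=> i j e; case: (ltngtP i j) => // /mono; rewrite e ltnn.
Qed.

Lemma coprime_fact r k : prime r -> (k < r)%N -> coprime r k`!.
Proof.
move=> r_pr; elim: k => [|k IH] kr; first by rewrite fact0 coprimen1.
by rewrite factS coprimeMr IH ?prime_coprime ?gtnNdvd // ltnW.
Qed.

Section PadicExtension.
Variables (R : realType) (q : nat) (Gam : {group 'S_q}) (p : nat).
Hypotheses (q_gt0 : (0 < q)%N) (sG : sigma q \in Gam).
Hypotheses (p_pr : prime p) (q_lt_p : (q < p)%N).
Local Open Scope ring_scope.

Definition padic_frac : set R :=
  [set a | exists i : int, exists j : nat, a = i%:~R / p%:R ^+ j].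

Definition padic_gens : set (iet R) :=
  [set rot a | a in padic_frac] `|` [set Etau R t | t in [set` Gam]].

Lemma p_neq0 : (p%:R != 0 :> R).
Proof. by rewrite pnatr_eq0 -lt0n prime_gt0. Qed.

Lemma padic_frac0 : padic_frac 0.
Proof. by exists 0, 0%N; rewrite mul0r. Qed.

Lemma padic_fracB a b : padic_frac a -> padic_frac b -> padic_frac (a - b).
Proof.
move=> [i [j ->]] [k [l ->]].
exists (i * p%:Z ^+ l - k * p%:Z ^+ j), (j + l)%N.
rewrite intrB !intrM !rmorphXn /= exprD -!pmulrn.
by field; rewrite !expf_neq0 ?p_neq0.
Qed.

Lemma padic_gensE f : padic_gens f ->
  (exists2 a, padic_frac a & f = rot a) \/
  (exists2 t, t \in Gam & f = Etau R t).
Proof.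
by case=> [[a Aa <-]|[t tG <-]]; [left; exists a|right; exists t].
Qed.

Lemma padic_infinite : infinite_set (gen padic_gens).
Proof.
apply: (@sub_infinite_set _ (range (fun j => rot (p%:R ^- j : R)))).
  move=> _ [j _ <-]; apply: sub_gen_set; left; exists (p%:R ^- j) => //.
  by exists 1, j; rewrite mul1r.
rewrite (eq_finite_set (inj_card_eq _)); first exact: infinite_nat.
move=> j k _ _ e.
have p0 : 0 < (p%:R : R) by rewrite ltr0n prime_gt0.
have p1 : 1 < (p%:R : R) by rewrite ltr1n prime_gt1.
have bnd i : 0 < (p%:R : R) ^- i <= 1.
  rewrite invr_gt0 exprn_gt0 //= invf_le1 ?exprn_gt0 //.
  by rewrite exprn_ege1 // ltW.
have [z zE] : exists z : int, (p%:R ^- j - p%:R ^- k : R) = z%:~R.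
  by apply: rot_eq1; rewrite rotD rotN e mulgV.
have /andP[j0 j1] := bnd j; have /andP[k0 k1] := bnd k.
(* Both p^-j and p^-k lie in ]0, 1], so they agree modulo 1 only if equal. *)
have z0 : z = 0 by apply: (@int_lt1 R); rewrite -zE; apply/andP; split; lra.
move: zE; rewrite z0 => /subr0_eq/invr_inj.
by apply: ieexprIn => //; rewrite gt_eqF.
Qed.

Lemma padic_n_solvable n : (0 < n)%N ->
  (Gam^`(n) = 1)%g -> (Gam^`(n.-1) <> 1)%g -> n_solvable n (gen padic_gens).
Proof.
apply: (@skew_n_solvable R q q_gt0 Gam sG) => [f /padic_gensE|t tG].
  by case=> [[a _ ->]|]; [left; exists a|right].
by apply: sub_gen_set; right; exists t.
Qed.

Lemma padic_torsion : has_torsion p (gen padic_gens).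
Proof.
exists (rot p%:R^-1); split.
- apply: sub_gen_set; left; exists p%:R^-1 => //.
  by exists 1, 1%N; rewrite mul1r.
- move=> /rot_eq1[z zE].
  have p1 : (1 < p%:R :> R) by rewrite ltr1n prime_gt1.
  have := @int_lt1 R z; rewrite -zE.
  have i0 : 0 < (p%:R^-1 : R) by rewrite invr_gt0 ltr0n prime_gt0.
  have i1 : (p%:R^-1 : R) < 1 by rewrite invf_lt1 // ltr0n prime_gt0.
  move=> z0; move: zE; rewrite z0; last by apply/andP; split; lra.
  by lra.
- by rewrite rotX -[_^-1 *+ _]mulr_natr mulVf ?p_neq0 // (rot_int _ 1).
Qed.

(** Writing an element of order r as k R_a with a = i / p^j, the number q r a is
    an integer; as p divides neither q nor r, this forces p^j to divide i, so
    that R_a is trivial.  The element k is fibrewise, and q! is prime to r. *)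
Lemma padic_no_torsion r : prime r -> (q < r)%N -> r <> p ->
  ~ has_torsion r (gen padic_gens).
Proof.
move=> r_pr q_lt_r rp [f [Hf f1 fr]]; apply: f1.
have [a [k [[i [j aE]] kG fE] [z zE]]] :=
  skew_torsion q_gt0 sG padic_frac0 padic_fracB padic_gensE Hf fr.
have pji : (p%:Z ^+ j %| i)%Z.
  have e : (q%:Z * r%:Z) * i = z * p%:Z ^+ j.
    apply: (@intr_inj R); rewrite !intrM rmorphXn /= -!pmulrn -zE aE.
    rewrite -[_ / _ *+ _]mulr_natr.
    by field; rewrite !expf_neq0 ?p_neq0.
  have : (p%:Z ^+ j %| (q%:Z * r%:Z) * i)%Z by rewrite e dvdz_mull.
  rewrite Gauss_dvdzr // coprimezE abszX abszM coprimeXl // coprimeMr.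
  rewrite !prime_coprime // gtnNdvd //=.
  by rewrite dvdn_prime2 //; apply/eqP => /esym.
have [c cE] := dvdzP pji.
have rot1 : rot a = 1%g.
  rewrite aE cE intrM rmorphXn /= -pmulrn mulfK ?expf_neq0 ?p_neq0 //.
  exact: rot_int.
rewrite rot1 mulg1 in fE; rewrite fE in fr *.
apply: (coprime_torsion (m := r) (k := q`!)) => //.
  exact: coprime_fact.
exact: fibrewise_exp kG.
Qed.

End PadicExtension.

Theorem proposition8p9 (R : realType) :
  (forall (s n m : nat) (alpha : 'I_s -> R) (g : 'I_m -> iet R)
          (G : {set 'S_(2 ^ n)}),
     (0 < s)%N -> (0 < n)%N -> (0 < m)%N ->
     (forall i, irrational_mod1 (alpha i)) ->
     Q_independent_mod1 alpha ->
     (forall j, G1q (2 ^ n) (g j)) ->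
     is_calG G ->
     frakS (gen (range g)) = [set` G] ->
     n_solvable n (HAQ alpha g))
  /\
  (forall n : nat, (0 < n)%N ->
     exists H : nat -> set (iet R),
       (forall k, [/\ is_subgroup (H k), infinite_set (H k) &
                      n_solvable n (H k)]) /\
       (forall i j, i <> j -> ~ isomorphic (H i) (H j))).
Proof.
split=> [s n m alpha g G _ n0 _ _ _ gE GG QG|n n0].
- have [_ sG Gn Gn1] := calG_derived GG.
  have q0 : (0 < 2 ^ n)%N by rewrite expn_gt0.
  pose Gam := group (is_calG_group GG).
  have memG t : t \in G <-> gen (range g) (Etau R t).
    by rewrite -[X in _ <-> X]/(frakS (gen (range g)) t) QG.
  apply: (@skew_n_solvable _ _ q0 Gam) => // [f [[i _ <-]|[j _ <-]]|t /memG].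
  + by left; exists (alpha i).
  + have [t _ te] := gE j; right; exists t => //.
    by apply/memG; rewrite te; apply: sub_gen_set; exists j.
  + apply: gen_sub; first exact: gen_subgroup.
    by move=> f gf; apply: sub_gen_set; right.
- have [G GG] := calG_exists n0; have [_ sG Gn Gn1] := calG_derived GG.
  have q0 : (0 < 2 ^ n)%N by rewrite expn_gt0.
  pose Gam := group (is_calG_group GG).
  pose p k := primes_above (2 ^ n) k.
  have p_pr k : prime (p k) := primes_above_prime _ k.
  have p_gt k : (2 ^ n < p k)%N := primes_above_gt _ k.
  exists (fun k => gen (@padic_gens R _ Gam (p k))); split=> [k|i j ij iso].
    split; [exact: gen_subgroup|exact: padic_infinite|].
    exact: padic_n_solvable.
  have tors : has_torsion (p i) (gen (@padic_gens R _ Gam (p j))).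
    apply: isomorphic_torsion iso _; first exact: gen_subgroup.
    exact: padic_torsion.
  have pij : p i <> p j by move=> /primes_above_inj.
  have no_tors := @padic_no_torsion R _ Gam (p j) q0 sG (p_pr j) (p_gt j) (p i).
  exact: no_tors (p_pr i) (p_gt i) pij tors.
Qed.
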